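(* Let $m=1$ and assume $W_{\bm q}$ is surjective. Let $p\in\bm q\text{-}\mathrm{Sym}_{k,n+1}$ be non-zero. (1) The minimal length $r$ of a $\bm q$-Symmetric decomposition over $\mathbb{K}$ of $p$ is at most $hk$. (2) If $p$ has a $\bm q$-Symmetric decomposition over $\mathbb{K}$ of length $r\leq\lfloor \frac{hk+1}{2}\rfloor$, then the decomposition is unique (up to permutation and rescaling) and $r$ is the minimal length of a $\bm q$-Symmetric decomposition of $p$ over $\mathbb{K}$. (3) Let $hk=2r-1$ and $\mathbb{K}=\mathbb{C}$. Then if $p$ is generic (i.e. $\psi_{\bm q}(p)$ is generic in $\mathcal{S}^{hk}(\mathbb{C}^2)$), the minimal length of a $\bm q$-Symmetric decomposition of $p$ over $\mathbb{C}$ is equal to $r$ and there exists a unique (up to permutation and rescaling) length $r$ $\bm q$-Symmetric decomposition of $p$ over $\mathbb{C}$. (4) Let $hk=2r-2$ and $\mathbb{K}=\mathbb{C}$. Then if $p$ is generic (i.e. $\psi_{\bm q}(p)$ is generic in $\mathcal{S}^{hk}(\mathbb{C}^2)$), the minimal length of a $\bm q$-Symmetric decomposition of $p$ over $\mathbb{C}$ is equal to $r$ and there exist infinitely many (up to permutation and rescaling) length $r$ $\bm q$-Symmetric decompositions of $p$ over $\mathbb{C}$.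
   Context: Let $\mathbb{K}=\mathbb{R}$ or $\mathbb{C}$, and $n,k,h$ positive integers. $\mathcal{S}^d(\mathbb{K}^{N+1})$ is the space of homogeneous polynomials (forms) of degree $d$ in $N+1$ variables over $\mathbb{K}$. Variables are $\bm X=(X_0,\dots,X_n)$ for $\mathcal{S}^k(\mathbb{K}^{n+1})$ and $\bm Z=(Z_0,Z_1)$ for binary forms. $\langle \bm v,\bm X\rangle=\sum_i v_iX_i$. Let $\bm q=(q_0,\dots,q_n)$ with $q_i\in\mathcal{S}^h(\mathbb{K}^{2})$. $W_{\bm q}:\mathcal{S}^k(\mathbb{K}^{n+1})\to\mathcal{S}^{hk}(\mathbb{K}^{2})$ is the linear map $\bm X^{\bm\alpha}\mapsto \prod_iq_i(\bm Z)^{\alpha_i}$. The apolar product on degree $d$ forms is the bilinear form $\langle f,g\rangle_d=\sum_{\bm\alpha}\binom{d}{\bm\alpha}^{-1}f_{\bm\alpha}g_{\bm\alpha}$ (where $f_{\bm\alpha},g_{\bm\alpha}$ are the monomial coefficients and $\binom{d}{\bm\alpha}=\frac{d!}{\prod\alpha_i!}$), and $A_d$ is the isomorphism $f\mapsto\langle f,\cdot\rangle_d$ onto the dual space. Put $\phi_{\bm q}=A_k^{-1}\circ W_{\bm q}^*\circ A_{hk}$, with $W_{\bm q}^*$ the transpose of $W_{\bm q}$, and $\bm q\text{-}\mathrm{Sym}_{k,n+1}:=\mathrm{Im}(\phi_{\bm q})\subseteq\mathcal{S}^k(\mathbb{K}^{n+1})$. When $W_{\bm q}$ is surjective, $\phi_{\bm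 q}$ is injective and $\psi_{\bm q}:\bm q\text{-}\mathrm{Sym}_{k,n+1}\to\mathcal{S}^{hk}(\mathbb{K}^{2})$ denotes its inverse. A $\bm q$-Symmetric decomposition of $p$ over $\mathbb{K}$ of length $r\in\mathbb{N}$ is an expression $p=\sum_{i=1}^r\lambda_i\langle\bm q(\bm\xi_i),\bm X\rangle^k$ with $\lambda_i\in\mathbb{K}\setminus\{0\}$ and $\bm\xi_i\in\mathbb{K}^{2}$ corresponding to different points of $\mathbb{P}^1(\mathbb{K})$. Up to permutation and rescaling means: up to reordering the summands and replacing $(\lambda_i,\bm\xi_i)$ by $(t^{-hk}\lambda_i,t\bm\xi_i)$ with $t\in\mathbb{K}\setminus\{0\}$. A statement holds for generic $f\in\mathcal{S}^{hk}(\mathbb{C}^2)$ if it holds for all $f$ whose coefficient vector lies in some Zariski open dense subset of $\mathbb{C}^{hk+1}$. *)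

(* Defs.v *)
From HB Require Import structures.
From mathcomp Require Import all_boot all_order all_fingroup all_algebra.
From mathcomp Require Import reals.
From mathcomp Require Import complex mpoly.

Set Implicit Arguments.
Unset Strict Implicit.
Unset Printing Implicit Defensive.

Import GRing.Theory.
Local Open Scope ring_scope.

(* S^d(K^(N+1)); the carrier [dhomog] includes the zero polynomial. *)
Notation hform K N d := (dhomog N.+1 K d).

Section Apolarity.
Variables (K : fieldType) (N d : nat).

Definition multinomial (a : 'X_{1..N.+1}) : K :=
  (d`!)%:R / (\prod_(i < N.+1) (a i)`!)%:R.

Definition apolar (f g : hform K N d) : K^o :=
  \sum_(a : 'X_{1..N.+1 < d.+1} | mdeg a == d)
    (multinomial a)^-1 * f@_a * g@_a.

Lemma apolar_is_linear f : linear (apolar f).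
Proof.
move=> c g g'; rewrite /apolar scaler_sumr -big_split /=.
by apply: eq_bigr => a _; rewrite linearP mulrDr /= [in LHS]mulrCA.
Qed.

HB.instance Definition _ f :=
  GRing.isLinear.Build K (hform K N d) K^o _ (apolar f) (apolar_is_linear f).

Definition apolar_fun (f : hform K N d) : 'Hom(hform K N d, K^o) :=
  linfun (apolar f).

Lemma apolar_fun_is_linear : linear apolar_fun.
Proof.
move=> c f f'; apply/lfunP => g; rewrite add_lfunE scale_lfunE !lfunE /=.
rewrite /apolar scaler_sumr -big_split /=.
by apply: eq_bigr => a _; rewrite linearP mulrDr mulrDl /= (mulrCA _ c) -(mulrA c).
Qed.

HB.instance Definition _ :=
  GRing.isLinear.Build K (hform K N d) 'Hom(hform K N d, K^o) _ apolar_fun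
    apolar_fun_is_linear.

(* A_d *)
Definition apolar_iso : 'Hom(hform K N d, 'Hom(hform K N d, K^o)) :=
  linfun apolar_fun.

End Apolarity.

Section QSymmetric.
Variables (K : fieldType) (n h k : nat).
Variable q : 'I_n.+1 -> hform K 1 h.

Definition subst_tuple : n.+1.-tuple {mpoly K[2]} :=
  [tuple (q i : {mpoly K[2]}) | i < n.+1].

Lemma subst_homog (f : hform K n k) : (f \mPo subst_tuple) \is (h * k).-homog.
Proof.
rewrite comp_mpolyEX big_seq; apply: rpred_sum => a af; apply: rpredZ.
have /dhomogP/(_ a af) <- := dhomog_is_dhomog f.
rewrite comp_mpolyX /= mdegE big_distrr /=.
elim/big_rec2: _ => [|i u v _ hv]; first exact: dhomog1.
apply: dhomogM hv; rewrite tnth_mktuple; apply: dhomogMn.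
exact: dhomog_is_dhomog.
Qed.

Definition subst_form (f : hform K n k) : hform K 1 (h * k) :=
  DHomog (subst_homog f).

Lemma subst_form_is_linear : linear subst_form.
Proof. by move=> c f f'; apply: val_inj; rewrite /= [LHS]linearP. Qed.

HB.instance Definition _ :=
  GRing.isLinear.Build K (hform K n k) (hform K 1 (h * k)) _ subst_form
    subst_form_is_linear.

(* W_q *)
Definition Wmap : 'Hom(hform K n k, hform K 1 (h * k)) := linfun subst_form.

Definition Wdual_fun (l : 'Hom(hform K 1 (h * k), K^o)) :
  'Hom(hform K n k, K^o) := (l \o Wmap)%VF.

Lemma Wdual_fun_is_linear : linear Wdual_fun.
Proof. by move=> c l l'; rewrite /Wdual_fun comp_lfunDl comp_lfunZl. Qed.

HB.instance Definition _ :=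
  GRing.isLinear.Build K 'Hom(hform K 1 (h * k), K^o) 'Hom(hform K n k, K^o) _
    Wdual_fun Wdual_fun_is_linear.

(* W_q^*, the transpose of W_q *)
Definition Wdual : 'Hom('Hom(hform K 1 (h * k), K^o), 'Hom(hform K n k, K^o)) :=
  linfun Wdual_fun.

(* [apolar_iso] is bijective in characteristic 0, where [^-1] is its inverse. *)
Definition phi : 'Hom(hform K 1 (h * k), hform K n k) :=
  ((apolar_iso K n k)^-1 \o Wdual \o apolar_iso K 1 (h * k))%VF.

Definition qSym : {vspace hform K n k} := limg phi.

(* The inverse of [phi] on [qSym] when [phi] is injective, i.e. when [Wmap] is
   surjective; it is only meant to be applied to elements of [qSym]. *)
Definition psi : 'Hom(hform K n k, hform K 1 (h * k)) := (phi^-1)%VF.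

Definition linear_form (v : 'I_n.+1 -> K) : {mpoly K[n.+1]} :=
  \sum_(i < n.+1) v i *: 'X_i.

Definition eval_q (xi : 'rV[K]_2) : 'I_n.+1 -> K := fun i => (q i).@[xi 0].

Definition same_point (x y : 'rV[K]_2) : Prop :=
  exists2 t : K, t != 0 & y = t *: x.

(* Summand i is encoded by the pair (lambda_i, xi_i). *)
Definition is_qdecomp (p : hform K n k) (r : nat) (D : 'I_r -> K * 'rV[K]_2) :=
  [/\ forall i, (D i).1 != 0,
      forall i, (D i).2 != 0,
      forall i j, i != j -> ~ same_point (D i).2 (D j).2
    & (p : {mpoly K[n.+1]}) =
        \sum_(i < r) (D i).1 *: linear_form (eval_q (D i).2) ^+ k].

Definition has_qdecomp (p : hform K n k) (r : nat) : Prop :=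
  exists D : 'I_r -> K * 'rV[K]_2, is_qdecomp p D.

Definition is_min_length (p : hform K n k) (r : nat) : Prop :=
  has_qdecomp p r /\ forall s, has_qdecomp p s -> (r <= s)%N.

(* Equality up to permutation and rescaling. *)
Definition qdecomp_equiv (r : nat) (D E : 'I_r -> K * 'rV[K]_2) : Prop :=
  exists s : 'S_r, forall i, exists2 t : K, t != 0 &
    E i = (t ^- (h * k) * (D (s i)).1, t *: (D (s i)).2).

Definition unique_qdecomp (p : hform K n k) (r : nat) : Prop :=
  exists D : 'I_r -> K * 'rV[K]_2, is_qdecomp p D /\
    forall E : 'I_r -> K * 'rV[K]_2, is_qdecomp p E -> qdecomp_equiv D E.

Definition infinitely_many_qdecomp (p : hform K n k) (r : nat) : Prop :=
  exists D : nat -> 'I_r -> K * 'rV[K]_2,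
    (forall a, is_qdecomp p (D a)) /\
    (forall a b, a != b -> ~ qdecomp_equiv (D a) (D b)).

End QSymmetric.

Section Zariski.
Variables (K : fieldType) (N : nat).
Implicit Types U Z : ('I_N -> K) -> Prop.

Definition zariski_closed Z : Prop :=
  exists S : {mpoly K[N]} -> Prop, forall x, Z x <-> forall P, S P -> P.@[x] = 0.

Definition zariski_open U : Prop := zariski_closed (fun x => ~ U x).

Definition zariski_dense U : Prop :=
  forall V : ('I_N -> K) -> Prop, zariski_open V ->
    (exists x, V x) -> exists x, V x /\ U x.

End Zariski.

(* Coefficients of the monomials Z_0^(d-i) Z_1^i. *)
Definition coef_vector (K : fieldType) (d : nat) (f : hform K 1 d) :
  'I_d.+1 -> K := fun i => f@_(U_(ord0) *+ (d - i) + U_(ord_max) *+ i)%MM.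

Definition generically (K : fieldType) (d : nat) (P : hform K 1 d -> Prop) :=
  exists U : ('I_d.+1 -> K) -> Prop,
    [/\ zariski_open U, zariski_dense U & forall f, U (coef_vector f) -> P f].

(* Main.v *)
Require Import Defs.
From HB Require Import structures.
From mathcomp Require Import all_boot all_order all_fingroup all_algebra.
From mathcomp Require Import zify separable.
From mathcomp Require Import boolp reals.
From mathcomp Require Import complex mpoly.

Set Implicit Arguments.
Unset Strict Implicit.
Unset Printing Implicit Defensive.

Import GRing.Theory.
Local Open Scope ring_scope.

(* Since <v,X>^k is apolar-dual to evaluation at v, the q-symmetric decompositions of
   phi(f) are exactly the Waring decompositions of the binary form f of degree d = hk,
   i.e. the expressions of the functional <f,.> as a combination of evaluations at
   distinct points of P^1; the rest is Sylvester's theory of binary forms.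
   Evaluations at d+1 distinct points are independent, since a product of linear forms
   separates a point from d others: this gives uniqueness and all lower bounds.  In terms
   of the moments c_j = <f, Z_0^(d-j) Z_1^j>, a decomposition supported at affine points
   is obtained from a separable polynomial with roots in K whose coefficients satisfy the
   corresponding linear recurrence on (c_j).  For part (1) such a polynomial of degree d
   always exists, unless f is a power of Z_1.  For parts (3) and (4) its coefficients are
   cofactors of a Hankel matrix, and genericity is the non-vanishing of the Hankel
   determinant and of a discriminant; in part (4) the moment c_(d+1) is a free parameter,
   distinct values of which give inequivalent decompositions. *)

(** * Apolarity and reduction to binary forms *)

Section PowersOfLinearForms.
Variables (K : fieldType) (n : nat).
Implicit Types (v : 'I_n.+1 -> K) (a b : 'X_{1..n.+1}).

Lemma prod_factU i b :
  (\prod_j ((U_(i) + b)%MM j)`! = (b i).+1 * \prod_j (b j)`!)%N.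
Proof.
rewrite (bigD1 i) //= [in RHS](bigD1 i) //= mnmDE mnm1E eqxx add1n factS.
rewrite !mulnA; congr (_ * _)%N; apply: eq_bigr => j ji.
by rewrite mnmDE mnm1E eq_sym (negPf ji).
Qed.

Lemma prod_expU v i b :
  \prod_j v j ^+ (U_(i) + b)%MM j = v i * \prod_j v j ^+ b j.
Proof.
rewrite (bigD1 i) //= [in RHS](bigD1 i) //= mnmDE mnm1E eqxx add1n exprS.
rewrite !mulrA; congr (_ * _); apply: eq_bigr => j ji.
by rewrite mnmDE mnm1E eq_sym (negPf ji).
Qed.

Lemma mcoeff_XM_eq0 (p : {mpoly K[n.+1]}) i a :
  a i = 0%N -> (p * 'X_i)@_a = 0.
Proof.
move=> ai0; apply: memN_msupp_eq0; apply/negP.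
rewrite (perm_mem (msuppMX p U_(i))) => /mapP[b _ ab].
by move: ai0; rewrite ab mnmDE mnm1E eqxx.
Qed.

(** The multinomial theorem with the factorials multiplied out. Induction on [k]: peeling off one
    factor sums over the variable removed from [a], and [k.+1 = \sum_i a i] splits the right-hand
    side accordingly. *)
Lemma mcoeff_linear_formX v k a : mdeg a = k ->
  (\prod_i (a i)`!)%:R * (linear_form v ^+ k)@_a
    = k`!%:R * \prod_i v i ^+ a i.
Proof.
elim: k a => [|k IHk] a.
  move=> /eqP; rewrite mdeg_eq0 => /eqP->; rewrite expr0 mcoeff1 eqxx mulr1.
  by rewrite !big1 ?mulr1 // => i _; rewrite mnm0E ?expr0.
move=> da; rewrite exprSr {2}/linear_form mulr_sumr raddf_sum mulr_sumr /=.
have -> : (k.+1)`!%:R * \prod_i v i ^+ a i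
  = \sum_i (a i)%:R * (k`!%:R * \prod_i v i ^+ a i).
  by rewrite -mulr_suml -natr_sum -mdegE da factS natrM mulrA.
apply: eq_bigr => i _; rewrite -scalerAr mcoeffZ.
case: (posnP (a i)) => [ai0|ai_gt0].
  by rewrite ai0 mul0r mcoeff_XM_eq0 // mulr0 mulr0.
have ab : a = (U_(i) + (a - U_(i)))%MM.
  rewrite addmC submK //; apply/mnm_lepP => j; rewrite mnm1E.
  by case: eqP => // <-.
move: (a - U_(i))%MM ab => b ab; move: da; rewrite ab mdegD mdeg1 => -[db].
rewrite mcoeffMX prod_factU prod_expU natrM mulrCA -mulrA IHk //.
by rewrite mnmDE mnm1E eqxx add1n; rewrite mulrCA; congr (_ * _); rewrite mulrCA.
Qed.

Lemma linear_formX_homog v k : linear_form v ^+ k \is k.-homog.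
Proof.
rewrite -[X in X.-homog]mul1n; apply: dhomogMn; apply: rpred_sum => i _.
by apply: rpredZ; rewrite dhomogX /= mdeg1.
Qed.

End PowersOfLinearForms.

Section Apolar.
Variables (K : fieldType) (N d : nat).
Hypothesis K0 : forall m, m.+1%:R != 0 :> K.

Lemma natr_neq0 m : (0 < m)%N -> m%:R != 0 :> K.
Proof. by case: m => // m _; exact: K0. Qed.

Lemma multinomial_neq0 (a : 'X_{1..N.+1}) : multinomial K d a != 0.
Proof.
rewrite mulf_neq0 ?invr_eq0 // natr_neq0 ?fact_gt0 //.
by rewrite prodn_gt0 // => i; rewrite fact_gt0.
Qed.

Lemma mcoeff_linear_formXE (v : 'I_N.+1 -> K) a : mdeg a = d ->
  (linear_form v ^+ d)@_a = multinomial K d a * \prod_i v i ^+ a i.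
Proof.
move=> /(mcoeff_linear_formX v) E.
have fact0 : (\prod_i (a i)`!)%:R != 0 :> K.
  by rewrite natr_neq0 // prodn_gt0 // => i; rewrite fact_gt0.
by apply: (mulfI fact0); rewrite E /multinomial mulrA mulrCA divff // mulr1.
Qed.

Definition hmonomial a (da : mdeg a == d) : hform K N d :=
  DHomog (eq_ind_r (fun b : bool => b) da (dhomogX K mdeg d a)).

Lemma apolarX (f : hform K N d) a (da : mdeg a == d) :
  apolar f (hmonomial da) = (multinomial K d a)^-1 * f@_a.
Proof.
have lt : (mdeg a < d.+1)%N by rewrite (eqP da).
rewrite /apolar (bigD1 (BMultinom lt)) //= mcoeffX eqxx mulr1.
rewrite big1 ?addr0 // => b /andP[_ nb]; rewrite mcoeffX.
by rewrite (_ : (a == b) = false) ?mulr0 //; apply/negP => /eqP ab;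
  case/eqP: nb; apply: val_inj.
Qed.

Lemma hform_ext (f g : hform K N d) :
  (forall a, mdeg a = d -> f@_a = g@_a) -> f = g.
Proof.
move=> fg; apply/val_inj/mpolyP => a.
have [/eqP/fg//|na] := boolP (mdeg a == d).
by rewrite (dhomog_nemf_coeff (valP f) na) (dhomog_nemf_coeff (valP g) na).
Qed.

(** A [d]-th power of a linear form is apolar-dual to evaluation: its multinomial coefficients
    cancel the weights of the product. The hypothesis on coefficients serves both decompositions and
    moments. *)
Lemma apolar_sum_eval (f : hform K N d) (g : {mpoly K[N.+1]}) (hg : g \is d.-homog)
    r (D : 'I_r -> K * ('I_N.+1 -> K)) :
  (forall a, mdeg a = d ->
     f@_a = \sum_i (D i).1 * (multinomial K d a * \prod_j (D i).2 j ^+ a j)) ->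
  apolar f (DHomog hg) = \sum_i (D i).1 * g.@[(D i).2].
Proof.
move=> fE; rewrite /apolar.
under eq_bigr => a /eqP da.
  rewrite fE // mulr_sumr mulr_suml.
  under eq_bigr => i _ do
    rewrite mulrCA [_^-1 * _]mulKf ?multinomial_neq0 //.
  over.
rewrite exchange_big /=; apply: eq_bigr => i _.
under eq_bigr do rewrite -mulrA.
rewrite -mulr_sumr; congr (_ * _).
have sg : (msize g <= d.+1)%N.
  rewrite mmeasureE; apply/bigmax_leqP_seq => a ag _.
  by rewrite ltnS (dhomog_mf hg ag).
rewrite [in RHS](mpolywE sg) raddf_sum /= [RHS](bigID (fun a => mdeg (bmnm a) == d)) /=.
rewrite [X in _ = _ + X]big1 ?addr0; last first.
  by move=> a na; rewrite (dhomog_nemf_coeff hg na) scale0r meval0.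
by apply: eq_bigr => a _; rewrite mevalZ mevalX mulrC.
Qed.

Lemma apolar_isoE (f g : hform K N d) : apolar_iso K N d f g = apolar f g.
Proof. by rewrite /apolar_iso lfunE /= lfunE. Qed.

(** Pairing with monomials recovers all coefficients up to nonzero factors, so [apolar_iso] is
    injective; equality of dimensions makes it onto. *)
Lemma apolar_isoK : cancel (apolar_iso K N d)^-1%VF (apolar_iso K N d).
Proof.
have inj : lker (apolar_iso K N d) == 0%VS.
  apply/lker0P => f g fg; apply: hform_ext => a /eqP da.
  have := congr1 (fun l : 'Hom(_, _) => l (hmonomial da)) fg.
  rewrite !apolar_isoE !apolarX.
  by move/mulfI; apply; rewrite invr_eq0 multinomial_neq0.
move=> l; apply: limg_lfunVK.
suff -> : limg (apolar_iso K N d) = fullv by rewrite memvf.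
apply/eqP; rewrite eqEdim subvf /= !dimvf /=.
rewrite limg_dim_eq ?dimvf ?(eqP inj) ?capv0 //.
by rewrite /dim /= muln1.
Qed.

End Apolar.

Section Reduction.
Variables (K : fieldType) (n h k : nat).
Hypothesis K0 : forall m, m.+1%:R != 0 :> K.
Variable q : 'I_n.+1 -> hform K 1 h.

(** [phi] is the adjoint of [Wmap] for the apolar products. *)
Lemma apolar_phi (f : hform K 1 (h * k)) (g : hform K n k) :
  apolar (phi k q f) g = apolar f (Wmap k q g).
Proof.
rewrite /phi !comp_lfunE.
have /lfunP/(_ g) := apolar_isoK K0 (Wdual k q (apolar_iso K 1 (h * k) f)).
by rewrite apolar_isoE => ->; rewrite lfunE /= comp_lfunE apolar_isoE.
Qed.

Lemma eval_Wmap (g : hform K n k) (x : 'rV[K]_2) :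
  (Wmap k q g : {mpoly K[2]}).@[x 0] = (g : {mpoly K[n.+1]}).@[eval_q q x].
Proof.
rewrite lfunE /= comp_mpoly_meval; apply: meval_eq => i.
by rewrite tnth_mktuple.
Qed.

Definition represents e (f : hform K 1 e) r (D : 'I_r -> K * 'rV[K]_2) :=
  forall g : hform K 1 e, apolar f g = \sum_i (D i).1 * (g : {mpoly K[2]}).@[(D i).2 0].

Definition distinct_points r (D : 'I_r -> K * 'rV[K]_2) :=
  (forall i, (D i).2 != 0) /\
  forall i j, i != j -> ~ same_point (D i).2 (D j).2.

Hypothesis W_surj : forall g, exists f : hform K n k, Wmap k q f = g.

(** By adjointness, and since [Wmap g] at [x] is [g] at [q x], both sides say that the two
    functionals agree on the image of [Wmap], which is everything by surjectivity. The converse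
    direction tests on monomials. *)
Lemma qdecompP (f : hform K 1 (h * k)) r (D : 'I_r -> K * 'rV[K]_2) :
  is_qdecomp q (phi k q f) D <->
  [/\ forall i, (D i).1 != 0, distinct_points D & represents f D].
Proof.
split=> [[lam0 pt0 dist E]|[lam0 [pt0 dist] rep]]; split=> //.
  move=> g; have [w <-] := W_surj g; rewrite -apolar_phi.
  case: w => w hw; pose D' i := ((D i).1, eval_q q (D i).2).
  rewrite (@apolar_sum_eval _ _ _ K0 _ _ _ _ D').
    by apply: eq_bigr => i _; rewrite eval_Wmap.
  move=> a da; rewrite E raddf_sum; apply: eq_bigr => i _ /=.
  by rewrite mcoeffZ mcoeff_linear_formXE.
have hs : \sum_(i < r) (D i).1 *: linear_form (eval_q q (D i).2) ^+ k \is k.-homog.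
  by apply: rpred_sum => i _; apply: rpredZ; apply: linear_formX_homog.
rewrite -[RHS]/(val (DHomog hs)); congr val; apply: hform_ext => a /eqP da.
apply: (@mulfI _ (multinomial K k a)^-1).
  by rewrite invr_eq0 multinomial_neq0.
rewrite -(apolarX _ da) apolar_phi rep raddf_sum mulr_sumr.
apply: eq_bigr => i _; rewrite eval_Wmap /= mevalX mcoeffZ mulrCA.
by rewrite mcoeff_linear_formXE ?(eqP da) // mulKf ?multinomial_neq0.
Qed.

End Reduction.

(** * Independence of evaluations *)

Section Points.
Variable K : fieldType.
Implicit Types x y : 'rV[K]_2.

Lemma row2_neq0 x : x != 0 -> exists i, x 0 i != 0.
Proof.
move=> x0; apply/existsP; apply: contraNT x0; rewrite negb_exists => /forallP x0.
by apply/eqP/rowP => i; rewrite mxE; apply/eqP; rewrite -[_ == _]negbK.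
Qed.

Lemma row2_ind (P : 'I_2 -> Prop) : P 0 -> P 1 -> forall i, P i.
Proof.
by move=> P0 P1 [[|[|//]] lt]; [move: P0|move: P1]; congr P; apply: val_inj.
Qed.

Lemma same_point_det x y : x != 0 -> y != 0 ->
  x 0 0 * y 0 1 = x 0 1 * y 0 0 -> same_point x y.
Proof.
move=> x0 y0 E; have [i xi0] := row2_neq0 x0.
have yE : y = (y 0 i / x 0 i) *: x.
  apply/rowP => j; rewrite mxE; apply: (mulfI xi0).
  rewrite mulrA mulrCA divff // mulr1.
  by move: i j {xi0}; apply: row2_ind; apply: row2_ind;
    rewrite [RHS]mulrC // -E mulrC.
exists (y 0 i / x 0 i) => //; apply: contraNneq y0 => t0.
by rewrite yE t0 scale0r.
Qed.

Lemma same_point_sym x y : same_point x y -> same_point y x.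
Proof.
by case=> t t0 ->; exists t^-1; rewrite ?invr_eq0 // scalerA mulVf // scale1r.
Qed.

Lemma same_point_trans x y z : same_point x y -> same_point y z -> same_point x z.
Proof.
by case=> t t0 -> [u u0 ->]; exists (u * t); rewrite ?mulf_neq0 // scalerA.
Qed.

Lemma eval_scale d (g : {mpoly K[2]}) (t : K) x : g \is d.-homog ->
  g.@[(t *: x) 0] = t ^+ d * g.@[x 0].
Proof.
move=> hg; rewrite !mevalE mulr_sumr; apply: eq_big_seq => a ag.
have <- : mdeg a = d := dhomog_mf hg ag.
rewrite mulrCA; congr (_ * _); rewrite mdegE.
rewrite expr_sum -big_split /=.
by apply: eq_bigr => i _; rewrite mxE exprMn.
Qed.

(** The product of the linear forms vanishing at the points of [s], padded to degree [d] by a power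
    of a coordinate that is nonzero at [x]. *)
Lemma separating_form d (s : seq 'rV[K]_2) x : x != 0 -> (size s <= d)%N ->
    (forall y, y \in s -> y != 0 /\ ~ same_point x y) ->
  exists2 g : hform K 1 d, (g : {mpoly K[2]}).@[x 0] != 0
    & forall y, y \in s -> (g : {mpoly K[2]}).@[y 0] = 0.
Proof.
move=> x0; elim: s d => [|y s IHs] d /=.
  have [i xi0] := row2_neq0 x0 => _ _.
  have hX : 'X_i ^+ d \is [in K[2], d.-homog].
    by rewrite -[X in X.-homog]mul1n; apply: dhomogMn; rewrite dhomogX /= mdeg1.
  by exists (DHomog hX) => //; rewrite /= rmorphXn /= mevalXU expf_neq0.
case: d => // d; rewrite ltnS => sd sP.
have [|g gx gs] := IHs d sd; first by move=> z zs; apply: sP; rewrite inE zs orbT.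
pose l : {mpoly K[2]} := y 0 1 *: 'X_0 - y 0 0 *: 'X_1.
have hl : l \is 1.-homog.
  by apply: rpredB; apply: rpredZ; rewrite dhomogX /= mdeg1.
have lE z : l.@[z 0] = z 0 0 * y 0 1 - z 0 1 * y 0 0.
  by rewrite mevalB !mevalZ !mevalXU mulrC [X in _ - X]mulrC.
have hgl : l * (g : {mpoly K[2]}) \is d.+1.-homog.
  exact: (dhomogM hl (valP g)).
exists (DHomog hgl) => /= [|z]; rewrite mevalM lE.
  rewrite mulf_neq0 // subr_eq0; apply/eqP => E.
  have [y0 nxy] := sP y (mem_head _ _).
  exact: nxy (same_point_det x0 y0 E).
rewrite inE => /predU1P[->|/gs->]; last by rewrite mulr0.
by rewrite mulrC [y 0 1 * _]mulrC subrr mulr0.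
Qed.

End Points.

Section Uniqueness.
Variables (K : fieldType) (d : nat) (f : hform K 1 d).
Variables (r s : nat) (D : 'I_r -> K * 'rV[K]_2) (E : 'I_s -> K * 'rV[K]_2).
Hypotheses (D0 : forall i, (D i).1 != 0) (Dpt : distinct_points D) (Ept : distinct_points E).
Hypotheses (Drep : represents f D) (Erep : represents f E).
Hypothesis rsd : (r + s <= d.+1)%N.

(** At most [(r - 1) + s <= d] points have to be killed. [J] is the full set when a partner of point
    [i] is sought, and the complement of the partner when coefficients are compared. *)
Lemma isolating_form (i : 'I_r) (J : {set 'I_s}) :
    (forall j, j \in J -> ~ same_point (D i).2 (E j).2) ->
  exists g : hform K 1 d, [/\ (g : {mpoly K[2]}).@[(D i).2 0] != 0,
    forall i', i' != i -> (g : {mpoly K[2]}).@[(D i').2 0] = 0 &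
    forall j, j \in J -> (g : {mpoly K[2]}).@[(E j).2 0] = 0].
Proof.
move=> nJ.
pose pts := [seq (D i').2 | i' in predC1 i] ++ [seq (E j).2 | j in J].
have [| |g gi gpts] := @separating_form K d pts (D i).2 (proj1 Dpt i).
- rewrite size_cat !size_map -!cardE cardC1 card_ord.
  have := max_card (mem J); rewrite card_ord => Js.
  rewrite -ltnS (leq_trans _ rsd) // -addSn prednK ?leq_add2l //.
  exact: leq_ltn_trans (ltn_ord i).
- move=> y; rewrite mem_cat => /orP[] /imageP[j].
    by move=> /= ji ->; split; [apply: (proj1 Dpt)|apply: (proj2 Dpt); rewrite eq_sym].
  by move=> jJ ->; split; [apply: (proj1 Ept)|apply: nJ].
exists g; split=> // j jP; apply: gpts; rewrite mem_cat; apply/orP.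
  by left; apply/imageP; exists j.
by right; apply/imageP; exists j.
Qed.

(** Without a partner, an isolating form would pair with [f] to a nonzero value through [D] and to
    zero through [E]. *)
Lemma represents_matching (i : 'I_r) : exists j, same_point (D i).2 (E j).2.
Proof.
have [//|nE] := boolp.pselect (exists j, same_point (D i).2 (E j).2).
have [|g [gi gD gE]] := @isolating_form i setT.
  by move=> j _ ij; apply: nE; exists j.
have := Drep g; rewrite Erep (bigD1 i) //= !big1 ?addr0.
- by move/esym/eqP; rewrite mulf_eq0 (negPf gi) (negPf (D0 i)).
- by move=> i' /gD->; rewrite mulr0.
- by move=> j _; rewrite gE ?mulr0 ?inE.
Qed.

Lemma represents_injection : exists2 sg : 'I_r -> 'I_s, injective sg &
  forall i, same_point (D i).2 (E (sg i)).2.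
Proof.
have [sg sgP] := boolp.choice represents_matching.
exists sg => // i j ij; apply/eqP/negPn/negP => /(proj2 Dpt); apply.
by apply: same_point_trans (sgP i) _; rewrite ij; apply: same_point_sym.
Qed.

Lemma represents_leq : (r <= s)%N.
Proof. by have [sg /leq_card] := represents_injection; rewrite !card_ord. Qed.

End Uniqueness.

(** The injection on points is a permutation as both lengths are [r]. A form isolating a point and
    its partner then compares the two coefficients, with the factor [t ^+ (h * k)] coming from
    homogeneity. *)
Lemma represents_unique (K : fieldType) (h k : nat) (f : hform K 1 (h * k)) r
    (D E : 'I_r -> K * 'rV[K]_2) :
    (forall i, (D i).1 != 0) -> distinct_points D -> distinct_points E ->
    represents f D -> represents f E -> (r + r <= (h * k).+1)%N ->
  qdecomp_equiv h k D E.
Proof.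
move=> D0 Dpt Ept Drep Erep rd.
have [sg sgI sgP] := represents_injection D0 Dpt Ept Drep Erep rd.
exists (perm sgI)^-1%g => j; rewrite -{1}[j](permKV (perm sgI)).
move: ((perm sgI)^-1%g j) => i {j}; rewrite permE.
have [t t0 tE] := sgP i; exists t => //.
rewrite [LHS]surjective_pairing tE; congr (_, _).
have [|g [gi gD gE]] := isolating_form Dpt Ept rd (i := i) (J := [set~ sg i]).
  move=> j; rewrite !inE => jS ij; have /(proj2 Ept) := jS; apply.
  by apply: same_point_trans (sgP i); apply: same_point_sym.
have := Drep g; rewrite Erep (bigD1 (sg i)) //= [in RHS](bigD1 i) //= !big1 ?addr0.
- rewrite tE (eval_scale _ _ (valP g)) mulrA => /(mulIf gi) <-.
  by rewrite mulrC mulfK // expf_neq0.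
- by move=> i' /gD->; rewrite mulr0.
- by move=> j ji; rewrite gE ?mulr0 ?inE.
Qed.

(** * Moments and linear recurrences *)

Section AffinePoints.
Variable K : fieldType.
Hypothesis K0 : forall m, m.+1%:R != 0 :> K.

(** The point [(1 : t)]. *)
Definition affine_point (t : K) : 'rV[K]_2 := \row_i t ^+ i.

Lemma affine_point_neq0 t : affine_point t != 0.
Proof.
by apply/eqP => /rowP/(_ 0); rewrite !mxE expr0 => /eqP; rewrite oner_eq0.
Qed.

Lemma same_affine_point s t : same_point (affine_point s) (affine_point t) -> s = t.
Proof.
case=> u _ E; have /rowP/(_ 0) := E; have /rowP/(_ 1) := E.
by rewrite !mxE expr0 !expr1 mulr1 => -> <-; rewrite mul1r.
Qed.

Definition affine_summands r (lam t : 'I_r -> K) i := (lam i, affine_point (t i)).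

Lemma affine_distinct r (lam t : 'I_r -> K) : injective t ->
  distinct_points (affine_summands lam t).
Proof.
move=> tI; split=> [i|i j ij /same_affine_point/tI/eqP]; last by rewrite (negPf ij).
exact: affine_point_neq0.
Qed.

Definition mono2 d i : 'X_{1..2} := (U_(ord0) *+ (d - i) + U_(ord_max) *+ i)%MM.

(** The apolar product of [f] with the monomial [Z_0^(d-i) Z_1^i]. *)
Definition moment d (f : hform K 1 d) i := (multinomial K d (mono2 d i))^-1 * f@_(mono2 d i).

Lemma mono2E d i : (mono2 d i ord_max = i) * (mono2 d i ord0 = d - i)%N.
Proof. by split; rewrite mnmDE !mulmnE !mnm1E /= ?mul0n ?mul1n ?addn0. Qed.

Lemma mono2_surj d (a : 'X_{1..2}) : mdeg a = d -> a = mono2 d (a ord_max).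
Proof.
have i0 : ord0 = 0 :> 'I_2 by apply: val_inj.
have i1 : ord_max = 1 :> 'I_2 by apply: val_inj.
rewrite mdegE big_ord_recr big_ord1 /= => da; apply/mnmP; apply: row2_ind.
  rewrite -i0 mono2E -da addnK; congr (a _); exact: val_inj.
by rewrite -i1 mono2E.
Qed.

Lemma mono2_le d (a : 'X_{1..2}) : mdeg a = d -> (a ord_max <= d)%N.
Proof. by rewrite mdegE big_ord_recr /= => <-; rewrite leq_addl. Qed.

Lemma moment_eq0 d (f : hform K 1 d) : (forall i, (i <= d)%N -> moment f i = 0) -> f = 0.
Proof.
move=> f0; apply: hform_ext => a da; rewrite mcoeff0 (mono2_surj da).
have /eqP := f0 _ (mono2_le da); rewrite mulf_eq0 invr_eq0.
by rewrite (negPf (multinomial_neq0 _ K0 _)) => /eqP.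
Qed.

Lemma represents_of_moments d (f : hform K 1 d) r (D : 'I_r -> K * 'rV[K]_2) :
  (forall j, (j <= d)%N ->
     moment f j = \sum_i (D i).1 * ((D i).2 0 0 ^+ (d - j) * (D i).2 0 1 ^+ j)) ->
  represents f D.
Proof.
move=> fE [g hg]; pose D' i := ((D i).1, (D i).2 0).
apply: (apolar_sum_eval K0 _ (D := D')) => a da.
have := fE _ (mono2_le da); rewrite /moment -(mono2_surj da).
move/(canRL (mulKf _)); rewrite invr_eq0 invrK => -> //; last exact: multinomial_neq0 K0 _.
rewrite mulr_sumr; apply: eq_bigr => i _; rewrite mulrCA; congr (_ * (_ * _)).
have i0 : ord0 = 0 :> 'I_2 by apply: val_inj.
have i1 : lift ord0 ord0 = 1 :> 'I_2 by apply: val_inj.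
have i1' : 1 = ord_max :> 'I_2 by apply: val_inj.
rewrite big_ord_recl big_ord1 i0 i1 -[a 0]/(a ord0) i1'.
by rewrite [in a ord0](mono2_surj da) mono2E.
Qed.

Lemma represents_of_power_sums d (f : hform K 1 d) r (lam t : 'I_r -> K) :
  (forall j, (j <= d)%N -> moment f j = \sum_i lam i * t i ^+ j) ->
  represents f (affine_summands lam t).
Proof.
move=> fE; apply: represents_of_moments => j /fE->; apply: eq_bigr => i _ /=.
by rewrite !mxE expr0 expr1n mul1r expr1.
Qed.

(** Summands with zero coefficient are dropped, whence the inequality on lengths. *)
Lemma represents_nonzero d (f : hform K 1 d) r (D : 'I_r -> K * 'rV[K]_2) :
    distinct_points D -> represents f D ->
  exists2 s, (s <= r)%N & exists E : 'I_s -> K * 'rV[K]_2,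
    [/\ forall i, (E i).1 != 0, distinct_points E & represents f E].
Proof.
move=> [pt0 dist] rep; pose A := [set i | (D i).1 != 0].
exists #|A|; first by rewrite -[X in (_ <= X)%N]card_ord max_card.
exists (D \o enum_val); split=> [i||g] /=.
- by have := enum_valP i; rewrite inE.
- split=> [i|i j ij] /=; first exact: pt0.
  by apply: dist; rewrite (inj_eq enum_val_inj).
rewrite rep (bigID (mem A)) /= [X in _ + X]big1 => [|i]; last first.
  by rewrite inE negbK => /eqP->; rewrite mul0r.
rewrite addr0.
by rewrite (big_enum_val (fun i => (D i).1 * (g : {mpoly K[2]}).@[(D i).2 0])).
Qed.

Lemma nat_inj : injective (fun m => m%:R : K).
Proof.
move=> m p; wlog mp : m p / (m <= p)%N => [W E|].
  by case: (leqP m p) => [|/ltnW] /W; [apply|move=> ->].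
move/eqP; rewrite eq_sym -subr_eq0 -natrB // => /eqP E.
apply/eqP; rewrite eqn_leq mp leqNgt /= -subn_gt0; apply/negP => /(natr_neq0 K0).
by rewrite E eqxx.
Qed.

Lemma nonroot_from (p : {poly K}) b : p != 0 ->
  exists2 m, (b <= m < b + size p)%N & p.[m%:R] != 0.
Proof.
move=> p0; pose s := [seq (m%:R : K) | m <- iota b (size p)].
have : ~~ all (root p) s.
  apply/negP => /(max_poly_roots p0); rewrite map_inj_uniq ?iota_uniq; last exact: nat_inj.
  by move=> /(_ isT); rewrite size_map size_iota ltnn.
by case/allPn => x /mapP[m mI ->] pm; exists m; rewrite -?mem_iota.
Qed.

Lemma nonroot (p : {poly K}) : p != 0 -> exists t, p.[t] != 0.
Proof. by move=> p0; have [m _ pm] := nonroot_from 0 p0; exists m%:R. Qed.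

(** Each window of [size p] consecutive integers contains a nonroot. Choosing one in the [a]-th
    window gives injectivity, as division by [size p] recovers [a]. *)
Lemma nonroot_sequence (p : {poly K}) : p != 0 ->
  exists2 u : nat -> K, injective u & forall a, p.[u a] != 0.
Proof.
move=> p0.
have sp : (0 < size p)%N by rewrite size_poly_gt0.
have /boolp.choice[u uP] a : exists m, (m %/ size p = a)%N /\ p.[m%:R] != 0.
  have [m /andP[am ma] pm] := nonroot_from (a * size p) p0.
  exists m; split=> //; apply/eqP; rewrite eqn_leq -ltnS ltn_divLR // leq_divRL //.
  by rewrite am mulSn addnC ma.
exists (fun a => (u a)%:R) => [a b /nat_inj E|a]; last exact: (uP a).2.
by rewrite -(uP a).1 -(uP b).1 E.
Qed.

Section PowerSums.
Variables (r : nat) (t : 'I_r -> K).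
Hypothesis tI : injective t.
Let V := Vandermonde r (\row_i t i).

Lemma Vandermonde_unit : V \in unitmx.
Proof.
rewrite unitmxE unitfE det_Vandermonde; apply/prodf_neq0 => i _.
apply/prodf_neq0 => j ij; rewrite !mxE subr_eq0.
by apply/eqP => /tI E; rewrite E ltnn in ij.
Qed.

Lemma power_sum_interpolation (c : nat -> K) :
  exists lam : 'I_r -> K, forall j, (j < r)%N -> c j = \sum_i lam i * t i ^+ j.
Proof.
pose x := invmx V *m \col_(j < r) c j; exists (fun i => x i 0) => j jr.
have /colP/(_ (Ordinal jr)) : V *m x = \col_j c j by rewrite mulKVmx ?Vandermonde_unit.
by rewrite !mxE => <-; apply: eq_bigr => i _; rewrite !mxE mulrC.
Qed.

(** The coefficients [lam] are fitted to the first [r] terms by inverting a Vandermonde matrix. Both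
    sequences obey the recurrence [G], whose leading coefficient is nonzero, so they agree up to
    [N]. *)
Lemma power_sums_of_recurrence (G : {poly K}) (c : nat -> K) N :
    size G = r.+1 -> (forall i, root G (t i)) ->
    (forall i, (i + r <= N)%N -> \sum_(j < r.+1) G`_j * c (i + j)%N = 0) ->
  exists lam : 'I_r -> K, forall j, (j <= N)%N -> c j = \sum_i lam i * t i ^+ j.
Proof.
move=> sG Gt rec; have [lam lamP] := power_sum_interpolation c.
exists lam; elim/ltn_ind => j IHj jN; case: (ltnP j r) => [|rj]; first exact: lamP.
pose m := (j - r)%N; have jE : j = (m + r)%N by rewrite subnK.
have lG : G`_r != 0.
  have : lead_coef G != 0 by rewrite lead_coef_eq0 -size_poly_gt0 sG.
  by rewrite lead_coefE sG.
apply: (mulfI lG); apply/eqP; rewrite -subr_eq0; apply/eqP.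
(* By induction all terms of this sum but the last vanish, and the whole sum vanishes by the two
   recurrences. *)
transitivity (\sum_(l < r.+1) G`_l * (c (m + l)%N - \sum_i lam i * t i ^+ (m + l))).
  rewrite big_ord_recr /= -jE mulrBr [X in _ = X + _]big1 ?add0r // => l _.
  have lj : (m + l < j)%N by rewrite jE ltn_add2l.
  by rewrite -IHj ?subrr ?mulr0 // (leq_trans (ltnW lj)).
under eq_bigr do rewrite mulrBr.
rewrite sumrB rec -?jE // sub0r; apply/eqP; rewrite oppr_eq0; apply/eqP.
under eq_bigr do rewrite mulr_sumr.
rewrite exchange_big /= big1 // => i _.
have /rootP := Gt i; rewrite horner_coef sG => Gti.
transitivity (lam i * t i ^+ m * \sum_(l < r.+1) G`_l * t i ^+ l); last by rewrite Gti mulr0.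
by rewrite mulr_sumr; apply: eq_bigr => l _; rewrite exprD [RHS]mulrCA !mulrA.
Qed.

End PowerSums.

End AffinePoints.

(** * Forms of degree d have length at most d *)

Section Pairing.
Variables (A : comNzRingType) (c : nat -> A) (N : nat).

(** For [c] the moments of [f] and [N = d.+1], this is the functional of [f] on dehomogenised forms.
    A general ring [A] allows roots that depend on a parameter. *)
Definition pairing (P : {poly A}) : A := \sum_(j < N) P`_j * c j.

Lemma pairingB P Q : pairing (P - Q) = pairing P - pairing Q.
Proof. by rewrite -sumrB; apply: eq_bigr => j _; rewrite coefB mulrBl. Qed.

Lemma pairing_mulXsubC P z :
  pairing (P * ('X - z%:P)) = pairing (P * 'X) - z * pairing P.
Proof.
rewrite mulrBr pairingB; congr (_ - _); rewrite mulr_sumr.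
by apply: eq_bigr => j _; rewrite coefMC [P`_j * z]mulrC mulrA.
Qed.

(** Makes the dependence on [u] polynomial, so that a generic [u] gives a nonzero pairing as soon as
    some [c j] with [j <= e] is nonzero. *)
Lemma pairing_binomial e u : (e < N)%N ->
  pairing (('X + u%:P) ^+ e) = (\poly_(i < e.+1) (c (e - i)%N *+ 'C(e, i))).[u].
Proof.
move=> eN; rewrite exprDn horner_poly /pairing.
under eq_bigr do rewrite coef_sum mulr_suml.
rewrite exchange_big /=; apply: eq_bigr => i _.
have lt : (e - i < N)%N by apply: leq_ltn_trans eN; rewrite leq_subr.
rewrite (bigD1 (Ordinal lt)) //= big1 ?addr0 => [|j ji].
  by rewrite coefMn -polyC_exp coefMC coefXn eqxx mul1r mulrnAl mulrnAl mulrC.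
rewrite coefMn -polyC_exp coefMC coefXn (_ : (_ == _) = false) ?mul0r ?mul0rn ?mul0r //.
by apply: contraNF ji => /eqP ji; apply/eqP/val_inj.
Qed.

End Pairing.

Lemma pairing_map (A B : comNzRingType) (phi : {rmorphism A -> B}) (c : nat -> A) N P :
  phi (pairing c N P) = pairing (phi \o c) N (map_poly phi P).
Proof.
by rewrite rmorph_sum; apply: eq_bigr => j _; rewrite rmorphM coef_map.
Qed.

Section Existence.
Variable K : fieldType.
Hypothesis K0 : forall m, m.+1%:R != 0 :> K.

Lemma binomial_poly_neq0 (c : nat -> K) e j : (j <= e)%N -> c j != 0 ->
  \poly_(i < e.+1) (c (e - i)%N *+ 'C(e, i)) != 0.
Proof.
move=> je cj; apply/eqP => /polyP/(_ (e - j)%N)/eqP; rewrite coef_poly coef0.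
rewrite ltnS leq_subr subKn // -mulr_natr mulf_eq0 (negPf cj) /=.
by rewrite (negPf (natr_neq0 K0 _)) // bin_gt0 leq_subr.
Qed.

(* All roots but one are -u, -u + x, -u + 2x, ...; the last one is then determined, and
   new, if certain pairings are nonzero.  These are polynomials in [x], whose values at 0
   are the pairings with ['X + u] to the powers [e] and [e.+1], nonzero for generic [u]. *)
Lemma exists_annihilator (c : nat -> K) e : (exists2 j, (j <= e)%N & c j != 0) ->
  exists rs : seq K, [/\ uniq rs, size rs = e.+1 &
    pairing c e.+2 (\prod_(z <- rs) ('X - z%:P)) = 0].
Proof.
case=> j je cj.
have Q0 := binomial_poly_neq0 je cj; have Q1 := binomial_poly_neq0 (leqW je) cj.
have [u] := nonroot K0 (mulf_neq0 Q0 Q1); rewrite hornerM mulf_eq0 negb_or => /andP[].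
rewrite -!(@pairing_binomial K c e.+2) // => u0 u1 {Q0 Q1}.
pose w i : {poly K} := (- u)%:P + i%:R *: 'X.
(* The inner variable of [{poly {poly K}}] is the spacing [x] of the roots. *)
pose G : {poly {poly K}} := \prod_(i <- iota 0 e) ('X - (w i)%:P).
pose c' := polyC \o c.
pose B := pairing c' e.+2 G; pose B' i := pairing c' e.+2 (G * ('X - (w i)%:P)).
pose z x i := - u + i%:R * x.
have wE x i : (w i).[x] = z x i by rewrite /w !hornerE.
have GE x : map_poly (horner_eval x) G = \prod_(y <- map (z x) (iota 0 e)) ('X - y%:P).
  rewrite rmorph_prod big_map; apply: eq_bigr => i _.
  by rewrite rmorphB /= map_polyX map_polyC /= /horner_eval wE.
have evE x P : (pairing c' e.+2 P).[x] = pairing c e.+2 (map_poly (horner_eval x) P).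
  rewrite -[LHS]/(horner_eval x _) pairing_map; apply: eq_bigr => i _ /=.
  by rewrite /horner_eval hornerC.
have BE x : B.[x] = pairing c e.+2 (\prod_(y <- map (z x) (iota 0 e)) ('X - y%:P)).
  by rewrite evE GE.
have B'E x i : (B' i).[x] =
    pairing c e.+2 (\prod_(y <- map (z x) (iota 0 e)) ('X - y%:P) * ('X - (z x i)%:P)).
  by rewrite evE rmorphM /= GE rmorphB /= map_polyX map_polyC /= /horner_eval wE.
have z0 i : z 0 i = - u by rewrite /z mulr0 addr0.
have prod0 : \prod_(y <- map (z 0) (iota 0 e)) ('X - y%:P) = ('X + u%:P) ^+ e.
  rewrite big_map (eq_bigr (fun=> 'X + u%:P)) => [|i _].
    by rewrite big_const_seq count_predT size_iota -Monoid.iteropE.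
  by rewrite z0 polyCN opprK.
have B0 : B != 0 by apply: contraNneq u0 => B0; rewrite -prod0 -BE B0 horner0.
have B'0 i : B' i != 0.
  apply: contraNneq u1 => Bi0; rewrite exprSr -prod0.
  by rewrite -[u]opprK -(z0 i) polyCN -B'E Bi0 horner0.
(* At a nonroot [x] of this product, ['X] keeps the roots [z x i] distinct, [B] makes the last root
   computable, and each [B' i] keeps it away from [z x i]. *)
have P0 : 'X * B * \prod_(i <- iota 0 e) B' i != 0.
  by rewrite !mulf_neq0 ?polyX_eq0 // prodf_seq_neq0; apply/allP => i _; exact: B'0.
have [x] := nonroot K0 P0; rewrite !hornerM hornerX horner_prod !mulf_eq0 !negb_or prodf_seq_neq0.
move=> /andP[/andP[x0]]; rewrite BE => Bx /allP B'x.
set H := \prod_(y <- _) _ in Bx; pose s := pairing c e.+2 (H * 'X) / pairing c e.+2 H.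
have sE : pairing c e.+2 (H * ('X - s%:P)) = 0.
  by rewrite pairing_mulXsubC /s divfK // subrr.
exists (s :: map (z x) (iota 0 e)); split.
- rewrite /= map_inj_uniq ?iota_uniq ?andbT.
    apply/negP => /mapP[i ie si].
    by have /= := B'x i ie; rewrite B'E -si -/H sE eqxx.
  by move=> i l /addrI/(mulIf x0)/(nat_inj K0).
- by rewrite /= size_map size_iota.
- by rewrite big_cons mulrC.
Qed.

(** A recurrence of order [d] on the moments [c_0, ..., c_d] is a single equation, solved by a
    polynomial with [d] distinct roots in [K] unless only [c_d] is nonzero. *)
Lemma exists_representation d (f : hform K 1 d) : (0 < d)%N -> f != 0 ->
  exists2 s, (s <= d)%N & exists E : 'I_s -> K * 'rV[K]_2,
    [/\ forall i, (E i).1 != 0, distinct_points E & represents f E].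
Proof.
case: d f => // e f _ f0; set c := moment f.
have [/(exists_annihilator)[rs [rsU rs_size Grs]]|c0] :=
  boolp.pselect (exists2 j, (j <= e)%N & c j != 0).
  pose t (i : 'I_e.+1) := rs`_i; set G := (X in pairing _ _ X) in Grs.
  have tI : injective t.
    by move=> i j /eqP; rewrite nth_uniq ?rs_size // => /eqP/val_inj.
  have sG : size G = e.+2 by rewrite size_prod_XsubC rs_size.
  have Gt i : root G (t i) by rewrite root_prod_XsubC mem_nth ?rs_size.
  have [|lam lamP] := power_sums_of_recurrence (c := c) (N := e.+1) tI sG Gt.
    move=> i; rewrite -[X in (_ <= X)%N]add0n leq_add2r leqn0 => /eqP->.
    exact: Grs.
  apply: (represents_nonzero (affine_distinct lam tI)).
  exact: (represents_of_power_sums K0).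
have {}c0 j : (j <= e)%N -> c j = 0.
  by move=> je; apply/eqP; rewrite -[_ == _]negbK; apply/negP => cj; apply: c0; exists j.
(* Here [f] is a multiple of the power of [Z_1], dual to evaluation at the point at infinity
   [(0 : 1)]. *)
pose D (i : 'I_1) := (c e.+1, \row_(j < 2) (j == 1)%:R : 'rV[K]_2).
exists 1%N => //; exists D; split=> [_| |] /=.
- apply: contra f0 => /eqP ce; apply/eqP/(moment_eq0 K0) => j.
  by rewrite leq_eqVlt => /predU1P[->//|]; exact: c0.
- split=> [i|i j]; last by rewrite !ord1.
  by apply/eqP => /rowP/(_ 1); rewrite !mxE eqxx => /eqP; rewrite oner_eq0.
apply: (represents_of_moments K0) => j; rewrite big_ord1 /= !mxE /= leq_eqVlt expr1n mulr1.
move=> /predU1P[->|je]; first by rewrite subnn expr0 mulr1.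
by rewrite -/c c0 // expr0n subn_eq0 leqNgt je mulr0.
Qed.

End Existence.

(** * Sylvester polynomials *)

Section SylvesterPolynomial.
Variables (A : comNzRingType) (c : nat -> A) (r : nat).

Definition hankel : 'M[A]_r := \matrix_(i, j) c (i + j)%N.

(** The adjugate, in place of an inverse, keeps everything polynomial in [c] and compatible with
    ring morphisms. *)
Definition sylvester_tail : 'cV[A]_r := \adj hankel *m \col_i c (i + r)%N.

(* By Cramer's rule, the generator of the degree [r] part of the apolar ideal. *)
Definition sylvester_poly : {poly A} :=
  \poly_(j < r.+1) (if insub j is Some i then - sylvester_tail i 0 else \det hankel).

Lemma coef_sylvester_poly (i : 'I_r) : sylvester_poly`_i = - sylvester_tail i 0.
Proof. by rewrite coef_poly (ltn_trans (ltn_ord i)) // valK. Qed.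

Lemma coef_sylvester_poly_lead : sylvester_poly`_r = \det hankel.
Proof. by rewrite coef_poly ltnSn insubF // ltnn. Qed.

Lemma size_sylvester_poly : \det hankel != 0 -> size sylvester_poly = r.+1.
Proof. by move=> h0; rewrite size_poly_eq // insubF ?ltnn. Qed.

Lemma lead_coef_sylvester_poly : \det hankel != 0 -> lead_coef sylvester_poly = \det hankel.
Proof.
by move=> h0; rewrite lead_coefE size_sylvester_poly // coef_sylvester_poly_lead.
Qed.

(** Row [i] of [hankel *m \adj hankel = (\det hankel)%:M], applied to the column of the
    [c (i + r)]. *)
Lemma sylvester_poly_recurrence i : (i < r)%N ->
  \sum_(j < r.+1) sylvester_poly`_j * c (i + j)%N = 0.
Proof.
move=> ir; rewrite big_ord_recr /= coef_sylvester_poly_lead.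
under eq_bigr do rewrite coef_sylvester_poly mulNr mulrC.
rewrite sumrN addrC; apply/eqP; rewrite subr_eq0; apply/eqP.
have /colP/(_ (Ordinal ir)) : hankel *m sylvester_tail = \det hankel *: \col_i c (i + r)%N.
  by rewrite mulmxA mul_mx_adj mul_scalar_mx.
by rewrite !mxE => <-; apply: eq_bigr => j _; rewrite mxE.
Qed.

(** Over a field of characteristic 0, it is nonzero exactly when [sylvester_poly] has degree [r] and
    is separable. *)
Definition sylvester_disc : A :=
  \det hankel * resultant sylvester_poly sylvester_poly^`().

End SylvesterPolynomial.

(** The Hankel matrix involves indices up to [2r - 2], and the last column adds [2r - 1]. *)
Lemma eq_sylvester_disc (A : comNzRingType) (c c' : nat -> A) r :
  (forall j, (j < r.*2)%N -> c j = c' j) -> sylvester_disc c r = sylvester_disc c' r.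
Proof.
move=> cc'; have hE : hankel c r = hankel c' r.
  by apply/matrixP => i j; rewrite !mxE cc' // -addnn -addSn leq_add // ltnW.
have tE : sylvester_tail c r = sylvester_tail c' r.
  rewrite /sylvester_tail hE; congr (_ *m _); apply/colP => i; rewrite !mxE cc' //.
  by rewrite -addnn ltn_add2r.
have pE : sylvester_poly c r = sylvester_poly c' r by rewrite /sylvester_poly tE hE.
by rewrite /sylvester_disc hE pE.
Qed.

Section SylvesterMap.
Variables (A B : comNzRingType) (phi : {rmorphism A -> B}).

(* A version of [map_resultant] for an arbitrary ring of coefficients. *)
Lemma rmorph_resultant (p q : {poly A}) :
    phi (lead_coef p) != 0 -> phi (lead_coef q) != 0 ->
  phi (resultant p q) = resultant (map_poly phi p) (map_poly phi q).
Proof.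
move=> p0 q0; rewrite /resultant /Sylvester_mx !size_map_poly_id0 // -det_map_mx.
rewrite map_col_mx; congr (\det (col_mx _ _)); apply: map_lin1_mx => v;
  by rewrite map_poly_rV rmorphM /= map_rVpoly.
Qed.

Lemma map_hankel c r : map_mx phi (hankel c r) = hankel (phi \o c) r.
Proof. by apply/matrixP => i j; rewrite !mxE. Qed.

Lemma map_sylvester_poly c r :
  map_poly phi (sylvester_poly c r) = sylvester_poly (phi \o c) r.
Proof.
apply/polyP => j; rewrite coef_map !coef_poly; case: ltnP => _; last exact: rmorph0.
case: insubP => [i _ _|_]; last by rewrite -map_hankel det_map_mx.
rewrite raddfN /sylvester_tail -map_hankel -map_mx_adj.
rewrite (_ : \col_i _ = map_mx phi (\col_i c (i + r)%N)); last by apply/colP => l; rewrite !mxE.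
by rewrite -map_mxM [in RHS]mxE.
Qed.

End SylvesterMap.

(** If the determinant maps to 0, both sides vanish. Otherwise the leading coefficients
    [\det hankel] and [r] times it survive, so the Sylvester matrices keep their size. *)
Lemma map_sylvester_disc (A : comNzRingType) (K : fieldType) (phi : {rmorphism A -> K}) c r :
    (forall m, m.+1%:R != 0 :> K) -> (0 < r)%N ->
  phi (sylvester_disc c r) = sylvester_disc (phi \o c) r.
Proof.
move=> K0 r_gt0; rewrite /sylvester_disc rmorphM -det_map_mx map_hankel.
have [->|h0] := eqVneq (\det (hankel (phi \o c) r)) 0; first by rewrite !mul0r.
congr (_ * _); rewrite -map_sylvester_poly deriv_map.
have ph0 : phi (\det (hankel c r)) != 0 by rewrite -det_map_mx map_hankel.
have hc0 : \det (hankel c r) != 0 by apply: contraNneq ph0 => ->; rewrite rmorph0.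
have dr : phi (sylvester_poly c r)^`()`_r.-1 != 0.
  rewrite coef_deriv prednK // coef_sylvester_poly_lead rmorphMn -mulr_natr.
  by rewrite mulf_neq0 ?natr_neq0.
have sd : size (sylvester_poly c r)^`() = r.
  apply/eqP; rewrite eqn_leq; apply/andP; split.
    have sp : sylvester_poly c r != 0 by rewrite -size_poly_gt0 size_sylvester_poly.
    by have := lt_size_deriv sp; rewrite size_sylvester_poly // ltnS.
  rewrite leqNgt; apply: contra dr => sd.
  by rewrite nth_default ?rmorph0 // -ltnS prednK.
by rewrite rmorph_resultant // ?lead_coef_sylvester_poly // lead_coefE sd.
Qed.

Section SylvesterField.
Variable K : fieldType.
Hypothesis K0 : forall m, m.+1%:R != 0 :> K.

Lemma hankel_power_sums r (lam t : 'I_r -> K) c :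
    (forall j, (j < r.*2)%N -> c j = \sum_i lam i * t i ^+ j) ->
  let V := Vandermonde r (\row_i t i) in
  hankel c r = V *m diag_mx (\row_i lam i) *m V^T.
Proof.
move=> cE V; apply/matrixP => i j.
have ij : (i + j < r.*2)%N by rewrite -addnn -addSn leq_add // ltnW.
rewrite !mxE cE //; apply: eq_bigr => l _.
by rewrite mul_mx_diag !mxE exprD mulrCA mulrA.
Qed.

(** A nonzero resultant gives [r] distinct roots, and the recurrence expresses [c] through their
    power sums. A zero coefficient would make the Hankel determinant vanish, by its factorisation
    through Vandermonde matrices. *)
Lemma sylvester_decomposition (c : nat -> K) r :
    (forall p : {poly K}, exists rs, p = lead_coef p *: \prod_(z <- rs) ('X - z%:P)) ->
    (0 < r)%N -> sylvester_disc c r != 0 ->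
  exists D : ('I_r -> K) * ('I_r -> K),
    [/\ injective D.2, forall i, D.1 i != 0 &
        forall j, (j < r.*2)%N -> c j = \sum_i D.1 i * D.2 i ^+ j].
Proof.
move=> splitK r_gt0; rewrite mulf_eq0 negb_or => /andP[h0 res0].
have sG := size_sylvester_poly h0; set G := sylvester_poly c r in res0 sG.
have [rs GE] := splitK G.
have lG : lead_coef G != 0 by rewrite lead_coef_eq0 -size_poly_gt0 sG.
have rsU : uniq rs.
  rewrite -separable_prod_XsubC -(eqp_separable (eqp_scale _ lG)) -GE.
  rewrite unlock /= -[coprimep _ _]negbK; move: res0; rewrite resultant_eq0 -leqNgt => sg.
  rewrite negbK /coprimep eqn_leq sg size_poly_gt0 gcdp_eq0 negb_and.
  by rewrite -size_poly_gt0 sG.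
have rs_size : size rs = r.
  by move: sG; rewrite GE size_scale // size_prod_XsubC => -[].
pose t (i : 'I_r) := rs`_i.
have tI : injective t.
  by move=> i j /eqP; rewrite nth_uniq ?rs_size // => /eqP/val_inj.
have Gt i : root G (t i).
  by rewrite GE rootZ // root_prod_XsubC mem_nth ?rs_size.
have [|lam lamP] := power_sums_of_recurrence (c := c) (N := r.*2.-1) tI sG Gt.
  move=> i ir; apply: sylvester_poly_recurrence.
  by rewrite -(ltn_add2r r) addnn (leq_ltn_trans ir) // prednK ?double_gt0.
exists (lam, t); split=> //= [i|j jr]; last first.
  by apply: lamP; rewrite -ltnS prednK ?double_gt0.
apply: contraNneq h0 => lam0.
rewrite (@hankel_power_sums r lam t) => [|j jr]; last first.
  by apply: lamP; rewrite -ltnS prednK ?double_gt0.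
by rewrite !det_mulmx det_diag (bigD1 i) //= mxE lam0 mul0r mulr0 mul0r.
Qed.

(** The witness is the sequence of power sums of [0, ..., r - 1]: its Hankel matrix is [V *m V^T],
    and its Sylvester polynomial has exactly these simple roots. *)
Lemma sylvester_disc_neq0 r : exists c : nat -> K, sylvester_disc c r != 0.
Proof.
pose t (i : 'I_r) : K := i%:R; pose c j := \sum_i t i ^+ j; exists c.
have tI : injective t by move=> i j /(nat_inj K0)/val_inj.
have Vu := Vandermonde_unit tI; set V := Vandermonde _ _ in Vu.
have h0 : \det (hankel c r) != 0.
  rewrite (@hankel_power_sums r (fun=> 1) t) => [|j _]; last first.
    by apply: eq_bigr => i _; rewrite mul1r.
  rewrite !det_mulmx det_tr det_diag big1 => [|i _]; last by rewrite mxE.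
  by rewrite mulr1 mulf_neq0 // -unitfE -unitmxE.
have sG := size_sylvester_poly h0; set G := sylvester_poly c r in sG.
have Gt i : root G (t i).
  (* Entry [a] is [\sum_i t i ^+ a * G.[t i]], the [a]-th instance of the recurrence; [V] is
     invertible. *)
  have : V *m \col_i G.[t i] = 0.
    apply/colP => a; rewrite !mxE -[RHS](sylvester_poly_recurrence c (ltn_ord a)).
    under eq_bigr do rewrite !mxE horner_coef sG mulr_sumr.
    rewrite exchange_big /=; apply: eq_bigr => j _; rewrite mulr_sumr.
    by apply: eq_bigr => l _; rewrite exprD mulrCA.
  by move/(congr1 (mulmx (invmx V))); rewrite mulKmx // mulmx0 => /colP/(_ i);
    rewrite !mxE => /eqP.
have tU : uniq (codom t) by rewrite map_inj_uniq ?enum_uniq.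
have GE : G = lead_coef G *: \prod_(z <- codom t) ('X - z%:P).
  apply: all_roots_prod_XsubC; first by rewrite sG size_codom card_ord.
    by apply/allP => _ /codomP[i ->].
  by rewrite uniq_rootsE.
have lG : lead_coef G != 0 by rewrite lead_coef_eq0 -size_poly_gt0 sG.
have : separable_poly G by rewrite GE (eqp_separable (eqp_scale _ lG)) separable_prod_XsubC.
rewrite unlock => /eqP sep.
by rewrite mulf_neq0 // resultant_eq0 sep.
Qed.

End SylvesterField.

(** * Genericity *)

Section Density.
Variables (K : fieldType) (N : nat).
Hypothesis K0 : forall m, m.+1%:R != 0 :> K.

(** Restriction of [P] to the line through [x] (parameter 0) and [y] (parameter 1). *)
Definition on_line (x y : 'I_N -> K) (P : {mpoly K[N]}) : {poly K} :=
  mmap polyC (fun i => (x i)%:P + (y i - x i) *: 'X) P.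

Lemma on_lineE x y P t : (on_line x y P).[t] = P.@[fun i => x i + (y i - x i) * t].
Proof.
rewrite /on_line /mmap mevalE horner_sum; apply: eq_bigr => a _.
rewrite hornerM hornerC horner_prod; congr (_ * _).
by apply: eq_bigr => i _; rewrite !hornerE.
Qed.

(** To meet a nonempty open set, join a point of each set by a line: the two restricted polynomials
    are nonzero, and so is their product, which has a nonroot. *)
Lemma zariski_dense_neq0 (T : Type) (P : T -> {mpoly K[N]}) :
    (exists x tau, (P tau).@[x] != 0) ->
  let U x := exists tau, (P tau).@[x] != 0 in zariski_open U /\ zariski_dense U.
Proof.
move=> [x [tau Px]] U; split.
  exists (fun Q => exists tau', Q = P tau') => z; split.
    move=> nU _ [tau' ->]; apply/eqP; rewrite -[_ == _]negbK; apply/negP => Pz.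
    by apply: nU; exists tau'.
  by move=> Sz [tau' /eqP]; apply; apply: Sz; exists tau'.
move=> V [S SV] [y Vy].
have [Q SQ Qy] : exists2 Q, S Q & Q.@[y] != 0.
  apply: boolp.contrapT => nQ; apply: (SV y).2 Vy => Q SQ.
  by apply/eqP; rewrite -[_ == _]negbK; apply/negP => Qy; apply: nQ; exists Q.
have px : (on_line x y (P tau)).[0] != 0.
  by rewrite on_lineE (meval_eq _ (v2 := x)) // => i; rewrite mulr0 addr0.
have qy : (on_line x y Q).[1] != 0.
  by rewrite on_lineE (meval_eq _ (v2 := y)) // => i; rewrite mulr1 addrC subrK.
have pq : on_line x y (P tau) * on_line x y Q != 0.
  rewrite mulf_neq0 //; first by apply: contraNneq px => ->; rewrite horner0.
  by apply: contraNneq qy => ->; rewrite horner0.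
have [t] := nonroot K0 pq; rewrite hornerM mulf_eq0 negb_or !on_lineE => /andP[Pt Qt].
exists (fun i => x i + (y i - x i) * t); split; last by exists tau.
by apply: boolp.contrapT => /SV/(_ Q SQ)/eqP; apply/negP.
Qed.

End Density.

Section Generic.
Variables (K : fieldType) (d r : nat).
Hypothesis K0 : forall m, m.+1%:R != 0 :> K.
Hypothesis r_gt0 : (0 < r)%N.

(** When [r.*2 = d.+2], the discriminant also involves the index [d.+1], where [tau] is the free
    parameter. *)
Definition extended_moment (f : hform K 1 d) tau j := if (j <= d)%N then moment f j else tau.

Definition generic_moment (tau : K) j : {mpoly K[d.+1]} :=
  if (j <= d)%N then (multinomial K d (mono2 d j))^-1 *: 'X_(inord j) else tau%:MP.

Lemma eval_generic_disc tau (x : 'I_d.+1 -> K) :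
  (sylvester_disc (generic_moment tau) r).@[x] =
  sylvester_disc (fun j => if (j <= d)%N then (multinomial K d (mono2 d j))^-1 * x (inord j)
                           else tau) r.
Proof.
rewrite (map_sylvester_disc (meval x) _ K0 r_gt0); apply: eq_sylvester_disc => j _ /=.
by rewrite /generic_moment; case: ifP => _; rewrite ?mevalZ ?mevalXU ?mevalC.
Qed.

Lemma eval_generic_moment_disc tau (f : hform K 1 d) :
  (sylvester_disc (generic_moment tau) r).@[coef_vector f] =
  sylvester_disc (extended_moment f tau) r.
Proof.
rewrite eval_generic_disc; apply: eq_sylvester_disc => j _.
rewrite /extended_moment; case: leqP => // jd; congr (_ * _).
by rewrite /coef_vector inordK.
Qed.

Lemma generically_sylvester_disc (P : hform K 1 d -> Prop) : (r.*2 <= d.+2)%N ->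
  (forall f, (exists tau, sylvester_disc (extended_moment f tau) r != 0) -> P f) ->
  generically P.
Proof.
move=> rd fP; have [c c0] := sylvester_disc_neq0 K0 r.
have [|Uo Ud] := @zariski_dense_neq0 K d.+1 K0 K (fun tau => sylvester_disc (generic_moment tau) r).
  (* The coefficients of a form with moments [c]; the index [d.+1] is the only one beyond [d] to be
     matched. *)
  exists (fun i : 'I_d.+1 => multinomial K d (mono2 d i) * c i), (c d.+1).
  rewrite eval_generic_disc (@eq_sylvester_disc _ _ c) // => j jr.
  have [jd|dj] := leqP j d; first by rewrite inordK // mulKf ?multinomial_neq0.
  by congr c; apply/eqP; rewrite eqn_leq dj -ltnS (leq_trans jr).
exists (fun x => exists tau, (sylvester_disc (generic_moment tau) r).@[x] != 0).
split=> // f [tau]; rewrite eval_generic_moment_disc => ft.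
by apply: fP; exists tau.
Qed.

Hypothesis splitK :
  forall p : {poly K}, exists rs, p = lead_coef p *: \prod_(z <- rs) ('X - z%:P).

Lemma sylvester_representation (f : hform K 1 d) tau : (d < r.*2)%N ->
    sylvester_disc (extended_moment f tau) r != 0 ->
  exists D : ('I_r -> K) * ('I_r -> K),
    let E := affine_summands D.1 D.2 in
    [/\ forall i, (E i).1 != 0, distinct_points E, represents f E &
        forall j, (j < r.*2)%N -> extended_moment f tau j = \sum_i D.1 i * D.2 i ^+ j].
Proof.
move=> dr /(sylvester_decomposition splitK r_gt0)[[lam t] /= [tI lam0 cE]].
exists (lam, t); split=> //; first exact: affine_distinct.
apply: (represents_of_power_sums K0) => j jd.
by rewrite -cE ?(leq_ltn_trans jd) // /extended_moment jd.
Qed.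

(** With the moments of [f] fixed, the discriminant is a polynomial in [tau]; being nonzero, it has
    infinitely many nonroots. *)
Lemma sylvester_disc_infinitely (f : hform K 1 d) tau :
    sylvester_disc (extended_moment f tau) r != 0 ->
  exists2 u : nat -> K, injective u &
    forall a, sylvester_disc (extended_moment f (u a)) r != 0.
Proof.
move=> ft; pose c j : {poly K} := if (j <= d)%N then (moment f j)%:P else 'X.
have cE s : (sylvester_disc c r).[s] = sylvester_disc (extended_moment f s) r.
  rewrite -[LHS]/(horner_eval s _) (map_sylvester_disc _ _ K0 r_gt0).
  apply: eq_sylvester_disc => j _; rewrite /= /horner_eval /c /extended_moment.
  by case: ifP => _; rewrite ?hornerC ?hornerX.
have [|u uI uP] := @nonroot_sequence K K0 (sylvester_disc c r).
  by apply: contraNneq ft => c0; rewrite -cE c0 horner0.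
by exists u => // a; rewrite -cE.
Qed.

(** The first coordinate 1 forces every rescaling factor to be 1, so power sums of all degrees, even
    beyond that of the form, are invariants. *)
Lemma affine_summands_equiv h k (lam t lam' t' : 'I_r -> K) j :
    qdecomp_equiv h k (affine_summands lam t) (affine_summands lam' t') ->
  \sum_i lam i * t i ^+ j = \sum_i lam' i * t' i ^+ j.
Proof.
case=> sg sgP; rewrite (reindex_inj (@perm_inj _ sg)); apply: eq_bigr => i _.
have [u _ [-> /rowP E]] := sgP i; have := E 0; have := E 1.
by rewrite !mxE !expr0 !expr1 mulr1 => -> <-; rewrite expr1n invr1 !mul1r.
Qed.

End Generic.

(** * Lengths, uniqueness and genericity for q-symmetric decompositions *)

Section Decompositions.
Variables (K : fieldType) (n h k : nat).
Hypothesis K0 : forall m, m.+1%:R != 0 :> K.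
Variable q : 'I_n.+1 -> hform K 1 h.
Hypothesis W_surj : forall g, exists f : hform K n k, Wmap k q f = g.
Hypothesis d_gt0 : (0 < h * k)%N.

Lemma qSym_phi (p : hform K n k) : p \in qSym k q -> p = phi k q (psi k q p).
Proof. by move=> /limg_lfunVK->. Qed.

Lemma psi_neq0 (p : hform K n k) : p \in qSym k q -> p != 0 -> psi k q p != 0.
Proof. by move=> /qSym_phi pE; apply: contra => /eqP p0; rewrite pE p0 linear0. Qed.

Lemma minimal_length (p : hform K n k) r : has_qdecomp q p r ->
  exists2 s, is_min_length q p s & (s <= r)%N.
Proof.
move=> pr; pose P s := boolp.asbool (has_qdecomp q p s).
have exP : exists s, P s by exists r; apply/boolp.asboolP.
exists (ex_minn exP); case: ex_minnP => s /boolp.asboolP ps smin.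
  by split=> // s' ps'; apply/smin/boolp.asboolP.
by apply: smin; apply/boolp.asboolP.
Qed.

Lemma qdecomp_leq (p : hform K n k) r s : p \in qSym k q ->
  has_qdecomp q p r -> has_qdecomp q p s -> (r + s <= (h * k).+1)%N -> (r <= s)%N.
Proof.
move=> /qSym_phi pE; rewrite pE => -[D /(qdecompP K0 W_surj)[D0 Dpt Drep]].
move=> [E /(qdecompP K0 W_surj)[E0 Ept Erep]].
exact: represents_leq D0 Dpt Ept Drep Erep.
Qed.

(** A length [s < r] would give [r + s <= 2r - 1 <= h * k + 1], within reach of [qdecomp_leq]. The
    bound [(h * k).+2] thus includes the even generic case. *)
Lemma qdecomp_minimal (p : hform K n k) r : p \in qSym k q ->
  (r.*2 <= (h * k).+2)%N -> has_qdecomp q p r -> is_min_length q p r.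
Proof.
move=> pq rd pr; split=> // s ps; rewrite leqNgt; apply/negP => sr.
have : (r <= s)%N.
  by apply: (qdecomp_leq pq pr ps); rewrite -ltnS (leq_trans _ rd) // -addnn ltn_add2l.
by rewrite leqNgt sr.
Qed.

Lemma qdecomp_unique (p : hform K n k) r : p \in qSym k q ->
  (r.*2 <= (h * k).+1)%N -> has_qdecomp q p r -> unique_qdecomp q p r.
Proof.
move=> /qSym_phi pE rd [D pD]; exists D; split=> // E.
rewrite pE in pD *; have [D0 Dpt Drep] := (qdecompP K0 W_surj _ _).1 pD.
move=> /(qdecompP K0 W_surj)[E0 Ept Erep].
by apply: represents_unique Drep Erep _ => //; rewrite addnn.
Qed.

Lemma qdecomp_exists (p : hform K n k) : p \in qSym k q -> p != 0 ->
  exists2 r, (r <= h * k)%N & has_qdecomp q p r.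
Proof.
move=> pq p0; have [r rd [E Erep]] := exists_representation K0 d_gt0 (psi_neq0 pq p0).
by exists r => //; exists E; rewrite (qSym_phi pq); apply/(qdecompP K0 W_surj).
Qed.

Hypothesis splitK :
  forall p : {poly K}, exists rs, p = lead_coef p *: \prod_(z <- rs) ('X - z%:P).

Lemma generic_odd r : (h * k = 2 * r - 1)%N ->
  generically (fun f : hform K 1 (h * k) =>
    forall p : hform K n k, p \in qSym k q -> p != 0 -> psi k q p = f ->
      is_min_length q p r /\ unique_qdecomp q p r).
Proof.
rewrite mul2n => dE; have rd : r.*2 = (h * k).+1 by lia.
have r_gt0 : (0 < r)%N by rewrite -double_gt0 rd.
apply: (generically_sylvester_disc K0 r_gt0); first by rewrite rd.
move=> f [tau ftau] p pq _ pf.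
have pr : has_qdecomp q p r.
  have [|D [D0 Dpt Drep _]] := sylvester_representation K0 r_gt0 splitK _ ftau.
    by rewrite rd.
  by exists (affine_summands D.1 D.2); rewrite (qSym_phi pq) pf; apply/(qdecompP K0 W_surj).
by split; [apply: qdecomp_minimal; rewrite ?rd|apply: qdecomp_unique; rewrite ?rd].
Qed.

Lemma generic_even r : (h * k = 2 * r - 2)%N ->
  generically (fun f : hform K 1 (h * k) =>
    forall p : hform K n k, p \in qSym k q -> p != 0 -> psi k q p = f ->
      is_min_length q p r /\ infinitely_many_qdecomp q p r).
Proof.
rewrite mul2n => dE; have rd : r.*2 = (h * k).+2 by lia.
have r_gt0 : (0 < r)%N by rewrite -double_gt0 rd.
apply: (generically_sylvester_disc K0 r_gt0); first by rewrite rd.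
move=> f [tau ftau] p pq _ pf.
have [u uI uP] := sylvester_disc_infinitely K0 r_gt0 ftau.
have dr : (h * k < r.*2)%N by rewrite rd.
have /boolp.choice[D DP] a := sylvester_representation K0 r_gt0 splitK dr (uP a).
have pD a : is_qdecomp q p (affine_summands (D a).1 (D a).2).
  have [D0 Dpt Drep _] := DP a.
  by rewrite (qSym_phi pq) pf; apply/(qdecompP K0 W_surj).
split.
  apply: qdecomp_minimal; rewrite ?rd //.
  by exists (affine_summands (D 0%N).1 (D 0%N).2).
exists (fun a => affine_summands (D a).1 (D a).2); split=> // a b ab.
(* The power sums of degree [h * k + 1] are the chosen parameters [u a] and [u b], which differ. *)
move=> /(affine_summands_equiv (h * k).+1).
have [_ _ _ <-] := DP a; last by rewrite rd.
have [_ _ _ <-] := DP b; last by rewrite rd.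
by rewrite /extended_moment ltnn => /uI/eqP; apply/negP.
Qed.

End Decompositions.

Theorem proposition3p26 (R : realType) (K : fieldType)
    (hK : K = (R : fieldType) \/ K = (R[i] : fieldType))
    (n k h : nat) (n_gt0 : (0 < n)%N) (k_gt0 : (0 < k)%N) (h_gt0 : (0 < h)%N)
    (q : 'I_n.+1 -> hform K 1 h)
    (W_surj : forall g : hform K 1 (h * k), exists f : hform K n k, Wmap k q f = g) :
  [/\ forall p : hform K n k, p \in qSym k q -> p != 0 ->
        exists2 r : nat, is_min_length q p r & (r <= h * k)%N,
      forall p : hform K n k, p \in qSym k q -> p != 0 ->
        forall r : nat, (r <= (h * k + 1) %/ 2)%N -> has_qdecomp q p r ->
          unique_qdecomp q p r /\ is_min_length q p r,
      forall r : nat, (h * k = 2 * r - 1)%N -> K = (R[i] : fieldType) ->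
        generically (fun f : hform K 1 (h * k) =>
          forall p : hform K n k, p \in qSym k q -> p != 0 -> psi k q p = f ->
            is_min_length q p r /\ unique_qdecomp q p r)
    & forall r : nat, (h * k = 2 * r - 2)%N -> K = (R[i] : fieldType) ->
        generically (fun f : hform K 1 (h * k) =>
          forall p : hform K n k, p \in qSym k q -> p != 0 -> psi k q p = f ->
            is_min_length q p r /\ infinitely_many_qdecomp q p r)].
Proof.
have K0 m : m.+1%:R != 0 :> K by case: hK => E; subst K; rewrite Num.Theory.pnatr_eq0.
have d_gt0 : (0 < h * k)%N by rewrite muln_gt0 h_gt0.
have splitK : K = (R[i] : fieldType) ->
    forall p : {poly K}, exists rs, p = lead_coef p *: \prod_(z <- rs) ('X - z%:P).
  move=> E; subst K => p; have [rs] := closed_field_poly_normal (p : {poly R[i]}).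
  by exists rs.
split.
- move=> p pq p0; have [r rd /minimal_length[s smin sr]] := qdecomp_exists K0 W_surj d_gt0 pq p0.
  by exists s => //; apply: leq_trans rd.
- move=> p pq _ r; rewrite leq_divRL // muln2 addn1 => rd pr.
  split; first exact: qdecomp_unique.
  by apply: qdecomp_minimal => //; apply: leqW.
- by move=> r dE /splitK splitK'; apply: generic_odd.
- by move=> r dE /splitK splitK'; apply: generic_even.
Qed.
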